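(* Let $M$ be a matroid of rank $2$ on $[n]$. Let $l$ be the number of loops of $M$, let $p$ be the number of parallel classes of $M$ of size at least $2$, and for each integer $k\ge 2$ let $n_k$ be the number of parallel classes of $M$ of size $k$. Then $$\mathbbm{1}(\mathcal{P}(M))=(1-p)\,\mathbbm{1}(\mathcal{P}(S(l+1,l+2)))+\sum_{k=2}^{n-1} n_k\,\mathbbm{1}(\mathcal{P}(S(l+1,l+k+1))).$$
   Context: A loop is an element of rank $0$; a parallel class of $M$ is a set $F\setminus L(M)$ where $F$ is a flat of rank $1$ and $L(M)$ is the set of loops. For $1\le x_1<x_2\le n$, $S(x_1,x_2)$ is the Schubert matroid of rank $2$ on $[n]$ whose bases are the $2$-subsets $\{b_1<b_2\}$ of $[n]$ with $b_1\ge x_1$, $b_2\ge x_2$. The base polytope $\mathcal{P}(M)\subset\mathbb{R}^n$ is the convex hull of the indicator vectors $\sum_{i\in B}e_i$ of the bases $B$ of $M$. For $X\subseteq\mathbb{R}^n$, the symmetrized indicator function is $\mathbbm{1}(X)(x)=\frac{1}{n!}\sum_{\sigma\in S_n}\overline{\mathbbm{1}}(X)(\sigma(x))$, where $\overline{\mathbbm{1}}(X)$ is the ordinary indicator function of $X$ and $S_n$ acts by permuting coordinates. *)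

(* Defs.v *)
From mathcomp Require Import all_boot all_order all_fingroup all_algebra.
From mathcomp Require Import all_classical reals numfun.

Set Implicit Arguments.
Unset Strict Implicit.
Unset Printing Implicit Defensive.

Import Order.TTheory GRing.Theory Num.Theory.
Local Open Scope ring_scope.

Definition matroid_bases (T : finType) (Bs : {set {set T}}) : Prop :=
  Bs != finset.set0 /\
  forall (A B : {set T}) (x : T), A \in Bs -> B \in Bs -> x \in A :\: B ->
    exists2 y, y \in B :\: A & y |: (A :\ x) \in Bs.

Record matroid (T : finType) := Matroid {
  bases :> {set {set T}};
  basesP : matroid_bases bases }.

Section Matroid.
Variables (T : finType) (M : matroid T).

Definition rank (A : {set T}) : nat := \max_(B in bases M) #|A :&: B|.

Definition loops : {set T} := [set x | rank [set x] == 0%N].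

Definition flat (F : {set T}) : bool :=
  [forall x, (x \notin F) ==> (rank F < rank (x |: F))%N].

Definition parallel_classes : {set {set T}} :=
  [set F :\: loops | F : {set T} & flat F && (rank F == 1%N)].

End Matroid.

(* The ground set [n] = {1, .., n} is encoded by 'I_n, with i : 'I_n standing
   for i.+1.  Outside the range x2 <= n this set is empty, hence not the set of
   bases of a matroid. *)
Definition schubert2_bases (n x1 x2 : nat) : {set {set 'I_n}} :=
  [set B : {set 'I_n} | [exists b1 : 'I_n, exists b2 : 'I_n,
    [&& (b1 < b2)%N, B == [set b1; b2], (x1 <= b1.+1)%N & (x2 <= b2.+1)%N]]].

Lemma schubert2_basesP (n x1 x2 : nat) (B : {set 'I_n}) :
  reflect (exists b1 b2 : 'I_n, [/\ (b1 < b2)%N, B = [set b1; b2],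
             (x1 <= b1.+1)%N & (x2 <= b2.+1)%N])
          (B \in schubert2_bases n x1 x2).
Proof.
rewrite inE; apply: (iffP existsP) => [[b1 /existsP[b2 /and4P[lt12 /eqP-> h1 h2]]]|].
  by exists b1, b2.
move=> [b1 [b2 [lt12 -> h1 h2]]]; exists b1; apply/existsP; exists b2.
by apply/and4P; split.
Qed.

Lemma schubert2_pair (n x1 x2 : nat) (a b : 'I_n) : (x1 < x2)%N ->
  ([set a; b] \in schubert2_bases n x1 x2) =
  [&& a != b, (x1 <= a.+1)%N, (x1 <= b.+1)%N & (x2 <= a.+1)%N || (x2 <= b.+1)%N].
Proof.
move=> x12; apply/schubert2_basesP/idP => [[b1 [b2 [lt12 E h1 h2]]]|].
  have : (a \in [set b1; b2]) && (b \in [set b1; b2]) by rewrite -E !inE !eqxx orbT.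
  have : (b1 \in [set a; b]) && (b2 \in [set a; b]) by rewrite E !inE !eqxx orbT.
  have n12 : b1 != b2 by rewrite -val_eqE neq_ltn lt12.
  have h1' : (x1 <= b2.+1)%N by rewrite (leq_trans h1)// ltnS ltnW.
  rewrite !inE => /andP[A1 A2] /andP[/orP[]/eqP ea /orP[]/eqP eb]; subst a b.
  - by move: A2; rewrite orbb eq_sym (negbTE n12).
  - by rewrite n12 h1 h1' h2 orbT.
  - by rewrite eq_sym n12 h1 h1' h2.
  - by move: A1; rewrite orbb (negbTE n12).
case/and4P => nab ha hb hab.
wlog ltab : a b nab ha hb hab / (a < b)%N => [H|].
  have [|] := ltnP a b; first exact: H.
  rewrite leq_eqVlt val_eqE eq_sym (negbTE nab)/= => ltba.
  by rewrite finset.setUC; apply: H; rewrite // 1?eq_sym// orbC.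
exists a, b; split=> //; case/orP: hab => // h; exact: leq_trans h (ltnW _).
Qed.

Lemma schubert2_matroid (n x1 x2 : nat) :
  (0 < x1)%N -> (x1 < x2)%N -> (x2 <= n)%N ->
  matroid_bases (schubert2_bases n x1 x2).
Proof.
move=> x1_gt0 x12 x2n; split.
  have i1 : (x1.-1 < n)%N by rewrite prednK// (leq_trans (ltnW x12)).
  have i2 : (x2.-1 < n)%N by rewrite prednK// (leq_trans _ x12).
  apply/set0Pn; exists [set Ordinal i1; Ordinal i2]; rewrite schubert2_pair//.
  have x2_gt0 := ltn_trans x1_gt0 x12.
  rewrite -val_eqE /= !prednK// leqnn (ltnW x12) leqnn orbT !andbT.
  by rewrite -eqSS !prednK// neq_ltn x12.
have pairE B : B \in schubert2_bases n x1 x2 -> forall x, x \in B ->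
    exists y, B = [set x; y].
  move=> /schubert2_basesP[b1 [b2 [_ -> _ _]]] x; rewrite !inE => /orP[]/eqP->.
    by exists b2.
  by exists b1; rewrite finset.setUC.
move=> A B x AS BS; rewrite inE => /andP[xB xA].
have [a EA] := pairE _ AS _ xA.
move: (AS); rewrite EA schubert2_pair// => /and4P[nxa hx ha hxa].
have -> : [set x; a] :\ x = [set a].
  by rewrite finset.setU1K// inE.
have [aB|aB] := boolP (a \in B).
  have [y EB] := pairE _ BS _ aB; exists y.
    move: BS; rewrite EB schubert2_pair// => /and4P[nay _ _ _].
    rewrite !inE eqxx orbT andbT negb_or [y == a]eq_sym nay andbT.
    by apply: contra xB => /eqP<-; rewrite EB !inE eqxx orbT.
  by rewrite finset.setUC -EB.
have /schubert2_basesP[b1 [b2 [lt12 EB h1 h2]]] := BS.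
have b2B : b2 \in B by rewrite EB !inE eqxx orbT.
exists b2.
  rewrite !inE b2B andbT negb_or; apply/andP; split.
    by apply: contra xB => /eqP<-.
  by apply: contra aB => /eqP<-.
rewrite schubert2_pair// h2 ha (leq_trans (ltnW x12) h2) !andbT.
by apply: contra aB => /eqP<-.
Qed.

Section Polytope.
Variable R : realType.

Definition convex_hull (E : lmodType R) (A : set E) : set E :=
  [set x | exists (m : nat) (w : 'I_m -> R) (v : 'I_m -> E),
    [/\ forall i, 0 <= w i, \sum_(i < m) w i = 1,
        forall i, A (v i) & x = \sum_(i < m) w i *: v i]].

Definition base_polytope (n : nat) (Bs : {set {set 'I_n}}) : set 'rV[R]_n :=
  convex_hull [set \sum_(i in B) delta_mx 0 i | B in [set` Bs]]%classic.

(* The sum ranges over all of 'S_n, so it does not matter whether a permutation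
   or its inverse acts on the coordinates. *)
Definition sym_indic (n : nat) (X : set 'rV[R]_n) (x : 'rV[R]_n) : R :=
  (n`!%:R)^-1 * \sum_(s : 'S_n) \1_X (col_perm s x).

End Polytope.

(* Main.v *)
(** The base polytope of a rank 2 matroid with loop set [L] is cut out of the
    slice [{0 <= x <= 1, x = 0 on L, sum x = 2}] by the inequalities
    [sum_(i in P) x_i <= 1], one for each parallel class [P].  Two disjoint
    classes cannot both violate their inequality on the slice, so the pieces cut
    off are disjoint, and inclusion-exclusion stops after the linear terms; a
    class of size 1 cuts off nothing.  The slice with the single inequality
    of [P] is, up to a permutation of coordinates, the base polytope of
    [S(l+1, l+|P|+1)]. *)
Require Import Defs.
From mathcomp Require Import all_boot all_order all_fingroup all_algebra.
From mathcomp Require Import all_classical reals numfun.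
From mathcomp Require Import zify ring lra.
Import Order.TTheory GRing.Theory Num.Theory.
Local Open Scope ring_scope.

(** * Parallel classes of a rank 2 matroid *)

Section RankTwo.
Context {T : finType} (M : matroid T).
Implicit Types (A B : {set T}) (i j k : T).

(** Exchanging an element of [A :\: B] for one of [B :\: A] keeps the size of [A] and shrinks
    [A :\: B]; once this difference is empty, [A] lies inside [B]. *)
Lemma card_bases_le A B : A \in bases M -> B \in bases M -> (#|A| <= #|B|)%N.
Proof.
move=> + MB; have [m] := ubnP #|A :\: B|; elim: m A => // m IHm A ltm MA.
have [/eqP|[x xAB]] := set_0Vmem (A :\: B).
  by rewrite finset.setD_eq0; exact: subset_leq_card.
have [y yBA MA'] := (basesP M).2 _ _ _ MA MB xAB.
move: (xAB) (yBA); rewrite !finset.inE => /andP[xB xA] /andP[yA yB].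
have <- : #|y |: (A :\ x)| = #|A|.
  by rewrite cardsU1 !finset.inE (negbTE yA) andbF (cardsD1 x A) xA.
apply: IHm MA'; apply: leq_trans (_ : #|A :\: B| <= m)%N; last by [].
apply: proper_card; apply/properP; split; last first.
  by exists x; rewrite // !finset.inE eqxx orbF xB; apply: contraNN xB => /eqP->.
apply/fintype.subsetP => z; rewrite !finset.inE => /andP[zB /orP[/eqP zy|/andP[_ ->]]].
  by rewrite zy yB in zB.
by rewrite zB.
Qed.

Lemma card_basis {B} : B \in bases M -> #|B| = rank M [set: T]%SET.
Proof.
move=> MB; apply/eqP; rewrite eqn_leq; apply/andP; split.
  by apply: leq_trans (leq_bigmax_cond _ MB); rewrite finset.setTI.
by apply/bigmax_leqP => A MA; rewrite finset.setTI card_bases_le.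
Qed.

Lemma nonloopP {i} : reflect (exists2 B, B \in bases M & i \in B) (i \notin loops M).
Proof.
rewrite finset.inE -lt0n; apply: (iffP idP) => [|[B MB iB]].
  apply: contraPP => noB; apply/negP; rewrite -leqNgt.
  apply/bigmax_leqP => B MB; rewrite leqn0 cards_eq0 finset.setI_eq0 disjoints1.
  by apply/negP => iB; apply: noB; exists B.
by apply: leq_trans (leq_bigmax_cond _ MB); rewrite lt0n cards_eq0 finset.setI_eq0 disjoints1 iB.
Qed.

Hypothesis rankM : rank M [set: T]%SET = 2%N.

Lemma basis_pair {B} : B \in bases M -> exists i j, i != j /\ B = [set i; j]%SET.
Proof.
by move=> /card_basis; rewrite rankM => /eqP/cards2P[i [j [nij ->]]]; exists i, j.
Qed.

(** Meant for nonloops [i]. At [j = i] the pair degenerates to a singleton, which is no basis in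
    rank 2, so [i] lies in its own class. For a loop [i] the set consists of all nonloops. *)
Definition parallel_class i : {set T} :=
  [set j | (j \notin loops M) && ([set i; j]%SET \notin bases M)]%SET.

Lemma basis_pair_mem {B i} : B \in bases M -> i \in B -> exists2 j, i != j & B = [set i; j]%SET.
Proof.
move=> /basis_pair[a [b [nab ->]]]; rewrite !finset.inE => /orP[]/eqP->; first by exists b.
by exists a; [rewrite eq_sym|rewrite finset.setUC].
Qed.

(** The nonloop [j] lies in some basis [{j, z}]. If [{i, k}] were a basis, exchanging [z] for one of
    its elements would make [{j, i}] or [{j, k}] a basis. *)
Lemma parallel_trans i j k : j \notin loops M ->
  [set i; j]%SET \notin bases M -> [set j; k]%SET \notin bases M ->
  [set i; k]%SET \notin bases M.
Proof.
move=> /nonloopP[B MB jB] ij jk; apply/negP => ik.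
have [z njz EB] := basis_pair_mem MB jB; subst B.
have zik : z \notin [set i; k]%SET.
  rewrite !finset.inE; apply/negP => /orP[]/eqP zE; subst z.
    by rewrite finset.setUC MB in ij.
  by rewrite MB in jk.
have [|y] := (basesP M).2 _ _ z MB ik; first by rewrite finset.in_setD zik !finset.inE eqxx orbT.
rewrite [[set j; z]%SET]finset.setUC finset.setU1K ?finset.inE 1?eq_sym//.
by move=> /andP[_ /orP[]/eqP->]; apply/negP; rewrite // finset.setUC.
Qed.

Lemma mem_parallel_class i : i \notin loops M -> i \in parallel_class i.
Proof.
move=> iL; rewrite finset.inE iL finset.setUid; apply/negP => /card_basis.
by rewrite cards1 rankM.
Qed.

(** By transitivity, not forming a basis is an equivalence relation on nonloops. Hence the bases are
    the two-coloured pairs of nonloops, with the class as colour. *)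
Lemma eq_parallel_class i j : i \notin loops M -> j \notin loops M ->
  (parallel_class i == parallel_class j) = ([set i; j]%SET \notin bases M).
Proof.
move=> iL jL; apply/eqP/idP => [E|ij].
  by have := mem_parallel_class j jL; rewrite -E finset.inE jL.
apply/setP => k; rewrite !finset.inE; congr (_ && _); apply/idP/idP.
  by apply: parallel_trans; rewrite // finset.setUC.
exact: parallel_trans.
Qed.

Lemma parallel_classE i j : i \notin loops M -> j \notin loops M ->
  (j \in parallel_class i) = (parallel_class j == parallel_class i).
Proof. by move=> iL jL; rewrite eq_sym eq_parallel_class// finset.inE jL. Qed.

(** A rank 1 flat contains no basis and absorbs everything parallel to one of its nonloops, so
    removing the loops leaves one class. Conversely, a class together with the loops is a rank 1
    flat. *)
Lemma parallel_classesP P :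
  reflect (exists2 i, i \notin loops M & P = parallel_class i) (P \in parallel_classes M).
Proof.
apply: (iffP imsetP) => [[F]|[i iL ->]].
  rewrite finset.inE => /andP[/fintype.forallP flatF /eqP rF] ->.
  have F1 B : B \in bases M -> (#|F :&: B| <= 1)%N.
    by move=> MB; rewrite -rF; exact: leq_bigmax_cond.
  have pairF i j : i != j -> i \in F -> j \in F -> [set i; j]%SET \notin bases M.
    move=> nij iF jF; apply/negP => /F1; rewrite (finset.setIidPr _) ?cards2 ?nij//.
    by apply/fintype.subsetP => z /finset.set2P[]->.
  have [i iF iL] : exists2 i, i \in F & i \notin loops M.
    apply/exists_inP; apply: contraPT rF => /exists_inPn FL.
    suff -> : rank M F = 0%N by [].
    apply/eqP; rewrite -leqn0; apply/bigmax_leqP => B MB.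
    rewrite leqn0 cards_eq0; apply/eqP/setP => j; rewrite !finset.inE.
    apply/negP => /andP[/FL/negP jL jB]; apply: jL.
    by apply/nonloopP; exists B.
  exists i => //; apply/setP => j; rewrite !finset.inE.
  have -> : (rank M [set j] == 0%N) = (j \in loops M) by rewrite finset.inE.
  have [//|jL] /= := boolP (j \in loops M).
  apply/idP/idP => [jF|ij].
    have [<-|nij] := eqVneq i j; last exact: pairF.
    by have := mem_parallel_class i iL; rewrite finset.inE => /andP[].
  (* If [j] were outside [F], adding it would not raise the rank: a basis [{j, k}] with [k] in [F]
     is impossible, since [k] is parallel to [i] and hence to [j]. *)
  apply: contraPT (flatF j) => jF; rewrite jF /=; apply/negP; rewrite -leqNgt rF.
  apply/bigmax_leqP => B MB; rewrite finset.setIUl.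
  have [jB|jB] := boolP (j \in B); last first.
    by rewrite (_ : [set j]%SET :&: B = finset.set0) ?finset.set0U ?F1 //;
       apply/eqP; rewrite finset.setI_eq0 disjoints1.
  have [k njk EB] := basis_pair_mem MB jB.
  have kF : k \notin F.
    apply/negP => kF.
    have ik : [set i; k]%SET \notin bases M.
      have [<-|nik] := eqVneq i k; last exact: pairF.
      by have := mem_parallel_class i iL; rewrite finset.inE => /andP[].
    have : [set j; k]%SET \notin bases M.
      by apply: parallel_trans iL _ ik; rewrite finset.setUC.
    by rewrite -EB MB.
  rewrite -finset.setIUl (_ : _ :&: B = [set j]%SET) ?cards1 //.
  apply/setP => z; rewrite EB !finset.inE; case: (eqVneq z j) => //= _.
  by case: (eqVneq z k) => [->|]; rewrite ?(negbTE kF) ?andbF.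
have disj : [disjoint loops M & parallel_class i].
  by rewrite -finset.setI_eq0; apply/eqP/setP => j; rewrite !finset.inE; case: (_ == _).
exists (loops M :|: parallel_class i); last first.
  by rewrite finset.setDUl finset.setDv finset.set0U; apply/esym/finset.setDidPl; rewrite disjoint_sym.
have rF : rank M (loops M :|: parallel_class i) = 1%N.
  apply/eqP; rewrite eqn_leq; apply/andP; split.
    apply/bigmax_leqP => B MB; have [a [b [nab EB]]] := basis_pair MB.
    have aL : a \notin loops M by apply/nonloopP; exists B; rewrite // EB !finset.inE eqxx.
    have bL : b \notin loops M by apply/nonloopP; exists B; rewrite // EB !finset.inE eqxx orbT.
    rewrite leqNgt; apply/negP => lt1.
    (* A basis meeting this set twice lies inside it, so both of its elements are parallel to [i]
       and therefore to each other. *)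
    have sub : B \subset loops M :|: parallel_class i.
      apply/finset.setIidPr/eqP; rewrite eqEcard finset.subsetIr /= (leq_trans _ lt1) //.
      by rewrite EB cards2 nab.
    have cls z : z \in B -> z \notin loops M -> [set i; z]%SET \notin bases M.
      move=> zB zL; have := fintype.subsetP sub z zB.
      by rewrite finset.in_setU (negbTE zL) finset.inE => /andP[].
    have : [set a; b]%SET \notin bases M.
      apply: parallel_trans iL _ _; first rewrite finset.setUC.
        by apply: cls; rewrite // EB !finset.inE eqxx.
      by apply: cls; rewrite // EB !finset.inE eqxx orbT.
    by rewrite -EB MB.
  have [B MB iB] := nonloopP iL.
  apply: leq_trans (leq_bigmax_cond _ MB); rewrite card_gt0; apply/set0Pn; exists i.
  by rewrite finset.in_setI iB finset.in_setU mem_parallel_class ?orbT.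
rewrite finset.inE rF eqxx andbT; apply/fintype.forallP => x; apply/implyP.
rewrite finset.in_setU negb_or => /andP[xL].
rewrite finset.inE xL /= negbK => ix.
(* The basis [{i, x}] lies in the enlarged set and witnesses rank 2. *)
apply: leq_trans (leq_bigmax_cond _ ix).
have nix : i != x.
  have := card_basis ix; rewrite rankM cards2; by case: eqP.
rewrite (finset.setIidPr _) ?cards2 ?nix ?rF //; apply/fintype.subsetP => z.
move=> /finset.set2P[]->; rewrite !finset.in_setU ?mem_parallel_class ?orbT //.
by rewrite finset.inE eqxx.
Qed.

End RankTwo.

(** * Convex combinations over arbitrary finite index types *)

Section ConvexHull.
Context {R : realType} {E : lmodType R} (A : set E).

(** Restricting to the support of [w] and enumerating it gives the ['I_m]-indexed form of the
    definition; points of weight 0 may thus lie outside [A]. *)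
Lemma convex_hull_sum (I : finType) (w : I -> R) (v : I -> E) :
  (forall i, 0 <= w i) -> \sum_i w i = 1 -> (forall i, w i != 0 -> A (v i)) ->
  convex_hull A (\sum_i w i *: v i).
Proof.
move=> w0 w1 Av; pose S := [set i | w i != 0]%SET.
have wS (V : zmodType) (F : I -> V) : (forall i, w i = 0 -> F i = 0) ->
    \sum_i F i = \sum_(i < #|S|) F (enum_val i).
  move=> F0; rewrite -big_enum_val.
  rewrite [RHS]big_mkcond; apply: eq_bigr => i _; rewrite finset.inE.
  by case: eqP => //= /F0.
exists #|S|, (w \o enum_val), (v \o enum_val); split => [i||i|] //=.
- by rewrite -w1 (wS _ w).
- by apply: Av; have := enum_valP i; rewrite finset.inE.
- by rewrite wS// => i ->; rewrite scale0r.
Qed.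

Lemma convex_hull_conv (x y : E) (t : R) : 0 <= t <= 1 ->
  convex_hull A x -> convex_hull A y -> convex_hull A (t *: x + (1 - t) *: y).
Proof.
move=> /andP[t0 t1] [m [w [v [w0 w1 Av ->]]]] [m' [w' [v' [w0' w1' Av' ->]]]].
pose W (i : 'I_m + 'I_m') := match i with inl i => t * w i | inr i => (1 - t) * w' i end.
pose V (i : 'I_m + 'I_m') := match i with inl i => v i | inr i => v' i end.
have -> : t *: (\sum_i w i *: v i) + (1 - t) *: (\sum_i w' i *: v' i)
    = \sum_i W i *: V i.
  rewrite big_sumType /= !scaler_sumr.
  by congr (_ + _); apply: eq_bigr => i _; rewrite scalerA.
apply: convex_hull_sum => [[i|i]||[i|i] _] //=.
- by rewrite mulr_ge0.
- by rewrite mulr_ge0 // subr_ge0.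
- by rewrite big_sumType /= -!mulr_sumr w1 w1'; ring.
Qed.

End ConvexHull.

(** * The polytope of two-coloured pairs, described by inequalities *)

Section ColouredPolytope.
Context {R : realType} {n : nat}.
Implicit Types x : 'rV[R]_n.

Lemma sum_delta_mx (B : {set 'I_n}) (j : 'I_n) :
  (\sum_(i in B) delta_mx 0 i : 'rV[R]_n) 0 j = (j \in B)%:R.
Proof.
rewrite summxE; under eq_bigr do rewrite mxE eqxx /=.
rewrite big_mkcond (bigD1 j) //= eqxx big1 ?addr0 => [|i nij]; first by case: ifP.
by rewrite eq_sym (negbTE nij) if_same.
Qed.

(** The value of a linear functional at a convex combination is the weighted mean of its values at
    the vertices. *)
Lemma base_polytope_le (Bs : {set {set 'I_n}}) (q : 'I_n -> R) (k : R) x :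
  (forall B, B \in Bs -> \sum_(i in B) q i <= k) ->
  base_polytope Bs x -> \sum_i q i * x 0 i <= k.
Proof.
move=> qk [m [w [v [w0 w1 Av ->]]]].
have -> : \sum_i q i * (\sum_(j < m) w j *: v j) 0 i
    = \sum_(j < m) w j * \sum_i q i * v j 0 i.
  under eq_bigr do rewrite summxE mulr_sumr.
  rewrite exchange_big /=; apply: eq_bigr => j _; rewrite mulr_sumr.
  by apply: eq_bigr => i _; rewrite mxE mulrCA.
rewrite -[leRHS]mul1r -w1 mulr_suml; apply: ler_sum => j _.
apply: ler_wpM2l => //; have [B /= BBs <-] := Av j.
apply: le_trans (qk _ BBs); rewrite [leRHS]big_mkcond /=; apply: ler_sum => i _.
by rewrite sum_delta_mx; case: (i \in B); rewrite ?mulr1 ?mulr0.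
Qed.

Context {T : eqType} (L : {set 'I_n}) (c : 'I_n -> T).

(** Common form of both applications, to [M] and to the Schubert matroids: [L] is the loop set and
    the colours name the parallel classes. A colour sum may run over elements of [L] too, but [x]
    vanishes there. *)
Definition feasible x :=
  [/\ forall i, 0 <= x 0 i, forall i, i \in L -> x 0 i = 0, \sum_i x 0 i = 2
    & forall i, i \notin L -> \sum_(j | c j == c i) x 0 j <= 1].

Context (Bs : {set {set 'I_n}})
  (BsP : forall B, B \in Bs <-> exists a b,
     [/\ B = [set a; b]%SET, a \notin L, b \notin L & c a != c b]).

(** Each condition is a linear inequality, or two opposite ones, and is checked on the vertices
    [e_a + e_b] with [a], [b] outside [L] and of different colours. *)
Lemma base_polytope_feasible x : base_polytope Bs x -> feasible x.
Proof.
move=> Px.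
have sum2 (q : 'I_n -> R) a b : c a != c b -> \sum_(i in [set a; b]%SET) q i = q a + q b.
  move=> nab; rewrite big_setU1 ?big_set1 //= finset.inE.
  by apply: contraNN nab => /eqP->.
have le (q : 'I_n -> R) k :
    (forall a b, a \notin L -> b \notin L -> c a != c b -> q a + q b <= k) ->
    \sum_i q i * x 0 i <= k.
  move=> qk; apply: base_polytope_le Px => B /BsP[a [b [-> aL bL nab]]].
  by rewrite sum2 //; exact: qk.
have pick (r : R) i : \sum_j (r *+ (j == i)) * x 0 j = r * x 0 i.
  rewrite (bigD1 i) //= eqxx big1 ?addr0 // => j /negbTE->; exact: mul0r.
have x0 i : 0 <= x 0 i.
  have := le (fun j => (-1) *+ (j == i)) 0; rewrite pick => H.
  suff : -1 * x 0 i <= 0 by lra.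
  by apply: H => a b _ _ _; do 2 case: eqP => _; rewrite /=; lra.
split=> // [i iL||i iL].
- apply/eqP; rewrite eq_le x0 andbT.
  have := le (fun j => 1 *+ (j == i)) 0; rewrite pick mul1r; apply.
  move=> a b aL bL _; do 2 (case: eqP => [?|_]; first by subst; rewrite iL in aL bL).
  by rewrite addr0.
- apply/eqP; rewrite eq_le; apply/andP; split.
    have := le (fun=> 1) 2; under eq_bigr do rewrite mul1r; apply => *; lra.
  have := le (fun=> -1) (-2); rewrite -mulr_sumr mulN1r lerN2; apply => *; lra.
- have := le (fun j => (c j == c i)%:R) 1.
  under eq_bigr do rewrite mulr_natl mulrb.
  rewrite -big_mkcond /=; apply => a b _ _.
  by case: (c a =P c i) => [->|_]; case: (c b =P c i) => [->|_];
    rewrite ?eqxx //= => _; lra.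
Qed.

(* With mass exactly 1 on a colour class, [x] is the product of its restrictions
   to the class and to its complement. *)
Lemma tight_base_polytope x i : feasible x -> \sum_(j | c j == c i) x 0 j = 1 ->
  base_polytope Bs x.
Proof.
move=> [x0 xL x2 _] x1.
pose u j := x 0 j *+ (c j == c i); pose v j := x 0 j *+ (c j != c i).
have uv j : x 0 j = u j + v j by rewrite /u /v; case: eqP; rewrite ?addr0 ?add0r.
have u1 : \sum_j u j = 1.
  by rewrite -x1 [RHS]big_mkcond; apply: eq_bigr => j _; rewrite /u mulrb.
have v1 : \sum_j v j = 1.
  by move: x2; under eq_bigr do rewrite uv; rewrite big_split /= u1; lra.
pose d j : 'rV[R]_n := delta_mx 0 j.
have -> : x = \sum_(p : 'I_n * 'I_n) (u p.1 * v p.2) *: (d p.1 + d p.2).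
  rewrite -(pair_bigA _ (fun a b => (u a * v b) *: (d a + d b))) /=.
  under eq_bigr => a _.
    under eq_bigr do rewrite scalerDr.
    rewrite big_split /= -scaler_suml -mulr_sumr v1 mulr1.
    over.
  rewrite big_split /= [X in _ + X]exchange_big /=.
  under [X in _ + X]eq_bigr do rewrite -scaler_suml -mulr_suml u1 mul1r.
  rewrite -big_split /= {1}(row_sum_delta x); apply: eq_bigr => j _.
  by rewrite uv scalerDl.
apply: convex_hull_sum => [[a b]||[a b]] /=.
- by apply: mulr_ge0; exact: mulrn_wge0.
- rewrite -(pair_bigA _ (fun a b => u a * v b)) /=.
  by under eq_bigr do rewrite -mulr_sumr v1 mulr1.
rewrite mulf_eq0 negb_or => /andP[ua vb].
have aL : a \notin L by apply: contraNN ua => /xL E; rewrite /u E mul0rn.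
have bL : b \notin L by apply: contraNN vb => /xL E; rewrite /v E mul0rn.
have ci : c a = c i by apply/eqP; apply: contraNT ua => /negbTE E; rewrite /u E mulr0n.
have nci : c b != c i by apply: contraNN vb => E; rewrite /v E mulr0n.
have nab : c a != c b by rewrite ci eq_sym.
exists [set a; b]%SET; first by apply/BsP; exists a, b.
rewrite big_setU1 ?big_set1 //= finset.inE.
by apply: contraNN nab => /eqP->.
Qed.

Let push x a b (t : R) : 'rV[R]_n := x + t *: (delta_mx 0 a - delta_mx 0 b).

Lemma sum_push x a b t (P : pred 'I_n) :
  \sum_(j | P j) push x a b t 0 j = \sum_(j | P j) x 0 j + t * ((P a)%:R - (P b)%:R).
Proof.
have D z : \sum_(j | P j) (delta_mx 0 z : 'rV[R]_n) 0 j = (P z)%:R.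
  rewrite big_mkcond (bigD1 z) //= big1 ?addr0 => [|i nij].
    by rewrite mxE !eqxx; case: ifP.
  by rewrite mxE (negbTE nij) andbF if_same.
rewrite -!D -sumrB mulr_sumr -big_split /=.
by apply: eq_bigr => j _; rewrite !mxE.
Qed.

(** Mass moves from [b] to [a] until something blocks: [t] is the smaller of the mass at [b] and the
    slack of the colour of [a]. In the first case [b] leaves the support and [IH] applies; in the
    second the colour of [a] becomes tight. *)
Lemma push_base_polytope x a b :
  (forall y, feasible y -> (forall j, x 0 j = 0 -> y 0 j = 0) -> y 0 b = 0 ->
     base_polytope Bs y) ->
  feasible x -> (forall i, i \notin L -> \sum_(j | c j == c i) x 0 j < 1) ->
  0 < x 0 a -> 0 < x 0 b -> c a != c b ->
  exists2 t, 0 < t & base_polytope Bs (push x a b t).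
Proof.
move=> IH [x0 xL x2 x1] lt1 a0 b0 nab.
have pL z : 0 < x 0 z -> z \notin L by move=> z0; apply/negP => /xL E; rewrite E ltxx in z0.
have [aL bL] := (pL a a0, pL b b0).
pose t := Num.min (x 0 b) (1 - \sum_(j | c j == c a) x 0 j); exists t.
  by rewrite lt_min b0 subr_gt0 lt1.
have t0 : 0 < t by rewrite lt_min b0 subr_gt0 lt1.
have tb : t <= x 0 b by rewrite ge_min lexx.
have ta : t <= 1 - \sum_(j | c j == c a) x 0 j by rewrite ge_min lexx orbT.
have nba : (b == a) = false by apply/negbTE; apply: contraNN nab => /eqP->.
have pE j : push x a b t 0 j = x 0 j + t * ((j == a)%:R - (j == b)%:R).
  by rewrite !mxE !eqxx.
have F : feasible (push x a b t).
  split=> [i|i iL||i iL].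
  - rewrite pE; case: eqP => [->|_]; last case: eqP => [->|_].
    + by rewrite eq_sym nba subr0 mulr1; have := x0 a; lra.
    + by rewrite /=; lra.
    + by rewrite subr0 mulr0 addr0.
  - rewrite pE xL // add0r.
    do 2 (case: eqP => [?|_]; first by subst; rewrite iL in aL bL).
    by rewrite subr0 mulr0.
  - by rewrite sum_push subrr mulr0 addr0.
  - rewrite sum_push; case: (eqVneq (c a) (c i)) => [<-|_].
      by rewrite eq_sym (negbTE nab) subr0 mulr1; lra.
    by have := x1 i iL; case: eqP => _ /=; lra.
have [E|E] : t = x 0 b \/ t = 1 - \sum_(j | c j == c a) x 0 j.
  by rewrite /t; case: leP => _; [left|right].
- apply: IH F _ _ => [j xj|]; rewrite pE.
    have ja : (j == a) = false by apply/eqP => ja; move: a0; rewrite -ja xj ltxx.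
    have jb : (j == b) = false by apply/eqP => jb; move: b0; rewrite -jb xj ltxx.
    by rewrite ja jb xj subr0 mulr0 addr0.
  by rewrite nba eqxx E sub0r mulrN1 subrr.
- apply: (tight_base_polytope _ a F).
  by rewrite sum_push eqxx [c b == _]eq_sym (negbTE nab) E subr0 mulr1 addrC subrK.
Qed.

(* Induction on the support: when no class has mass 1, [x] lies strictly between
   two points obtained by moving mass between two colours, each of which is tight
   or has smaller support. *)
Lemma feasible_base_polytope x : feasible x -> base_polytope Bs x.
Proof.
have [m] := ubnP #|[set i | x 0 i != 0]%SET|; elim: m x => // m IHm x ltm F.
have [x0 xL x2 x1] := F.
have [/existsP[i /eqP xi]|] := boolP [exists i, \sum_(j | c j == c i) x 0 j == 1].
  exact: tight_base_polytope xi.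
move=> /existsPn nt.
have lt1 i : i \notin L -> \sum_(j | c j == c i) x 0 j < 1.
  by move=> /x1; rewrite le_eqVlt (negbTE (nt i)).
have pos (P : pred 'I_n) : 0 < \sum_(j | P j) x 0 j -> exists2 a, P a & 0 < x 0 a.
  move=> s0; apply/exists_inP; apply: contraTT s0.
  move=> /exists_inPn np; rewrite -leNgt; apply: sumr_le0 => i /np.
  by rewrite -leNgt.
have [a _ a0] : exists2 a, true & 0 < x 0 a by apply: pos; rewrite x2.
have aL : a \notin L by apply/negP => /xL E; rewrite E ltxx in a0.
(* The colour of [a] carries less than 1 of the total mass 2, so another colour carries some. *)
have [b nab b0] : exists2 b, c b != c a & 0 < x 0 b.
  by apply: pos; move: x2; rewrite (bigID (fun j => c j == c a)) /=; have := lt1 a aL; lra.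
have IH z : 0 < x 0 z -> forall y, feasible y -> (forall j, x 0 j = 0 -> y 0 j = 0) ->
    y 0 z = 0 -> base_polytope Bs y.
  move=> z0 y Fy yx yz; apply: IHm => //; apply: leq_trans (ltm : (_ <= m)%N).
  apply: proper_card; apply/properP; split.
    apply/fintype.subsetP => j; rewrite !finset.inE.
    by apply: contraNN => /eqP/yx->.
  by exists z; rewrite !finset.inE ?yz ?eqxx // gt_eqF.
have [t t0 Pt] := push_base_polytope x b a (IH a a0) F lt1 b0 a0 nab.
have [|s s0 Ps] := push_base_polytope x a b (IH b b0) F lt1 a0 b0 _.
  by rewrite eq_sym.
have ts : 0 < t + s by rewrite addr_gt0.
(* The pushes displace [x] along one line in opposite directions, by [t] and [s]; the weights
   [s / (t + s)] and [t / (t + s)] cancel the displacements. *)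
have -> : x = (s / (t + s)) *: push x b a t + (1 - s / (t + s)) *: push x a b s.
  have E : 1 - s / (t + s) = t / (t + s) by field; rewrite gt_eqF.
  apply/rowP => j; rewrite E !mxE; field; by rewrite gt_eqF.
apply: convex_hull_conv => //.
by rewrite divr_ge0 ?(ltW s0) ?(ltW ts) //= ler_pdivrMr // mul1r lerDr ltW.
Qed.

Lemma base_polytopeP x : base_polytope Bs x <-> feasible x.
Proof. by split; [exact: base_polytope_feasible|exact: feasible_base_polytope]. Qed.

End ColouredPolytope.

(** * Slices of the cube, their symmetry, and Schubert matroids *)

Lemma card_ord_interval (n a b : nat) : (b <= n)%N ->
  #|[set i : 'I_n | (a <= i < b)%N]%SET| = (b - a)%N.
Proof.
move=> bn; rewrite -[RHS]muln1 -sum_nat_const_nat big_geq_mkord.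
rewrite (big_ord_widen_cond n (fun i => a <= i)%N (fun=> 1%N)) // -sum1_card.
by apply: eq_bigl => i; rewrite finset.inE.
Qed.

Section Slice.
Context {R : realType} {n : nat}.
Implicit Types (x y : 'rV[R]_n) (L P : {set 'I_n}).

(** For empty [P] the last condition is vacuous, and the slice is the second hypersimplex on the
    complement of [L]. *)
Definition slice L P : set 'rV[R]_n :=
  [set x | [/\ forall i, 0 <= x 0 i <= 1, forall i, i \in L -> x 0 i = 0,
               \sum_i x 0 i = 2 & \sum_(i in P) x 0 i <= 1]]%classic.

Lemma indic_iff (X Y : set 'rV[R]_n) x y : (X x <-> Y y) -> \1_X x = \1_Y y :> R.
Proof.
move=> XY; rewrite !indicE; congr (_%:R); congr nat_of_bool.
by apply/idP/idP; rewrite !in_setE => /XY.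
Qed.

(** For a singleton the class inequality is just a coordinate bound. This lets the uncut slice be
    read as the case of a class of size 1. *)
Lemma slice_card_le1 L P : (#|P| <= 1)%N -> slice L P = slice L finset.set0.
Proof.
move=> P1; apply/seteqP; split => x [x01 xL x2 _]; split=> //.
  by rewrite big_set0.
move: P1; rewrite leq_eqVlt ltnS leqn0 cards_eq0 => /orP[/cards1P[i ->]|/eqP->].
  by rewrite big_set1; have /andP[] := x01 i.
by rewrite big_set0.
Qed.

Lemma slice_col_perm (s : 'S_n) L P L' P' x :
  (forall i, (s i \in L') = (i \in L)) -> (forall i, (s i \in P') = (i \in P)) ->
  slice L P (col_perm s x) <-> slice L' P' x.
Proof.
move=> sL sP; pose y := col_perm s x.
have yE i : y 0 i = x 0 (s i) by rewrite mxE.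
have y2 : \sum_i y 0 i = \sum_i x 0 i.
  by under eq_bigr do rewrite yE; rewrite [RHS](reindex_perm s).
have yP : \sum_(i in P) y 0 i = \sum_(i in P') x 0 i.
  by under eq_bigr do rewrite yE; rewrite [RHS](reindex_perm s); apply: eq_bigl => i; rewrite sP.
split; rewrite -/y => -[x01 xL x2 x1].
  split=> [i|i iL||]; rewrite -?y2 -?yP //.
    by have := x01 (s^-1 i)%g; rewrite yE permKV.
  by have := xL (s^-1 i)%g; rewrite yE permKV; apply; rewrite -sL permKV.
split=> [i|i iL||]; rewrite ?y2 ?yP ?yE //.
by apply: xL; rewrite sL.
Qed.

(** Label each [i] by its memberships in [L] and [P]. Disjointness excludes the label
    [(true, true)], so the sizes determine how often each label occurs, and the two label sequences
    are rearrangements of each other. *)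
Lemma perm_of_disjoint L P L' P' : [disjoint L & P] -> [disjoint L' & P'] ->
  #|L| = #|L'| -> #|P| = #|P'| ->
  exists s : 'S_n, (forall i, (s i \in L') = (i \in L)) /\ (forall i, (s i \in P') = (i \in P)).
Proof.
move=> dLP dLP' eL eP.
pose f (L P : {set 'I_n}) i := (i \in L, i \in P).
suff /tuple_permP[s sE] : perm_eq [tuple f L P i | i < n] [tuple f L' P' i | i < n].
  have H i : f L P i = f L' P' (s i).
    have := congr1 (fun t => nth (f L P i) t i) sE.
    by rewrite -!tnth_nth !tnth_mktuple.
  by exists s; split=> i; case: (H i).
have cnt (K Q : {set 'I_n}) (b : bool * bool) : [disjoint K & Q] ->
    count_mem b [tuple f K Q i | i < n] =
    (match b with (true, true) => 0 | (true, false) => #|K|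
     | (false, true) => #|Q| | (false, false) => n - #|K| - #|Q| end)%N.
  move=> dKQ; rewrite count_map.
  have -> : count (preim (f K Q) (pred1 b)) (enum 'I_n) = #|[set i | f K Q i == b]%SET|.
    rewrite -size_filter cardE /enum_mem; congr size; rewrite -enumT filter_predT.
    by apply: eq_filter => i; rewrite [RHS]finset.inE.
  have KQ i : (i \in K) && (i \in Q) = false.
    by apply/negP => /andP[iK]; apply/negP; rewrite (disjointFr dKQ).
  case: b => [[] []].
  - by apply/eqP; rewrite cards_eq0; apply/eqP/setP => i; rewrite !finset.inE xpair_eqE !eqb_id KQ.
  - by apply: eq_card => i; rewrite finset.inE xpair_eqE eqb_id eqbF_neg; have := KQ i; do 2 case: (_ \in _).
  - by apply: eq_card => i; rewrite finset.inE xpair_eqE eqb_id eqbF_neg; have := KQ i; do 2 case: (_ \in _).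
  - rewrite -subnDA -[X in (X - _)%N]card_ord.
    have -> : (#|K| + #|Q| = #|K :|: Q|)%N by rewrite cardsU (disjoint_setI0 dKQ) cards0 subn0.
    rewrite -[K :|: Q]finset.setCK -cardsCs; apply: eq_card => i.
    by rewrite !finset.inE xpair_eqE !eqbF_neg negb_or.
by apply/allP => b _ /=; rewrite !cnt // eL eP.
Qed.

(** A permutation [t] carrying one pair of sets to the other is absorbed by the average, through the
    substitution of [t * s] for [s]. *)
Lemma sym_indic_slice L P L' P' x : [disjoint L & P] -> [disjoint L' & P'] ->
  #|L| = #|L'| -> #|P| = #|P'| -> sym_indic (slice L P) x = sym_indic (slice L' P') x.
Proof.
move=> dLP dLP' eL eP; have [t [tL tP]] := perm_of_disjoint L P L' P' dLP dLP' eL eP.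
congr (_ * _); rewrite (reindex_inj (mulgI t)); apply: eq_bigr => s _.
rewrite col_permM; apply: indic_iff; exact: slice_col_perm.
Qed.

Lemma base_polytope_schubert2 (l k : nat) : (0 < k)%N ->
  base_polytope (schubert2_bases n l.+1 (l + k).+1) =
  slice [set i : 'I_n | (i < l)%N]%SET [set i : 'I_n | (l <= i < l + k)%N]%SET.
Proof.
move=> k0; pose L := [set i : 'I_n | (i < l)%N]%SET.
(* This colour merges all indices below [l + k] into one, loops included, and keeps the later ones
   distinct. Indices start at 0, so the loops are the [i < l]. *)
pose c (i : 'I_n) := maxn i (l + k).-1.
have BsP B : B \in schubert2_bases n l.+1 (l + k).+1 <-> exists a b,
    [/\ B = [set a; b]%SET, a \notin L, b \notin L & c a != c b].
  have lk : (l.+1 < (l + k).+1)%N by lia.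
  have E a b : ([set a; b]%SET \in schubert2_bases n l.+1 (l + k).+1) =
      [&& a \notin L, b \notin L & c a != c b].
    by rewrite schubert2_pair // !finset.inE -val_eqE /c /=; lia.
  split=> [BS|[a [b [-> aL bL nab]]]]; last by rewrite E aL bL.
  have /schubert2_basesP[a [b [_ EB _ _]]] := BS.
  by subst B; move: BS; rewrite E => /and3P[aL bL nab]; exists a, b.
have H (x : 'rV[R]_n) : base_polytope (schubert2_bases n l.+1 (l + k).+1) x <-> feasible L c x.
  exact: base_polytopeP.
apply/seteqP; split=> x.
  move=> /H[x0 xL x2 x1]; split=> // [i|].
    rewrite x0 /=; have [/xL->|iL] := boolP (i \in L); first exact: ler01.
    apply: le_trans (x1 i iL); rewrite (bigD1 i) //= lerDl.
    by apply: sumr_ge0.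
  (* Any element of the block supplies its inequality; the block may be empty in ['I_n]. *)
  have [->|/set0Pn[i]] := eqVneq [set i : 'I_n | (l <= i < l + k)%N]%SET finset.set0.
    by rewrite big_set0 ler01.
  rewrite finset.inE => lik; apply: le_trans (x1 i _); last by rewrite finset.inE; lia.
  rewrite big_mkcond [leRHS]big_mkcond /=; apply: ler_sum => j _.
  rewrite finset.inE /c; case: ifP => [ljk|_]; last by case: ifP.
  by rewrite ifT //; lia.
move=> [x01 xL x2 x1]; apply/H; have x0 i : 0 <= x 0 i by have /andP[] := x01 i.
split=> // i iL; have [ilk|ilk] := ltnP i (l + k).
  apply: le_trans x1; rewrite big_mkcond [leRHS]big_mkcond /=; apply: ler_sum => j _.
  case: ifP => [/eqP cji|_]; last by case: ifP.
  have [/xL->|jL] := boolP (j \in L); first by rewrite if_same.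
  by rewrite ifT // finset.inE; move: cji jL; rewrite /c finset.inE; lia.
(* Past the block each colour has a single element, and its inequality is the coordinate bound. *)
rewrite (big_pred1 i) => [|j]; first by have /andP[] := x01 i.
by rewrite -[RHS]val_eqE /= /c; lia.
Qed.

End Slice.

(** * The base polytope of [M] and its indicator in terms of slices *)

Section MatroidPolytope.
Context {R : realType} {n : nat} (M : matroid 'I_n).
Hypothesis rankM : rank M [set: 'I_n]%SET = 2%N.
Implicit Types (x y : 'rV[R]_n) (P : {set 'I_n}).

Lemma base_polytope_rank2 x : base_polytope (bases M) x <->
  slice (loops M) finset.set0 x /\
  forall P, P \in parallel_classes M -> \sum_(i in P) x 0 i <= 1.
Proof.
have BsP B : B \in bases M <-> exists a b, [/\ B = [set a; b]%SET,
    a \notin loops M, b \notin loops M & parallel_class M a != parallel_class M b].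
  split=> [MB|[a [b [-> aL bL]]]]; last by rewrite eq_parallel_class // negbK.
  have [a [b [nab EB]]] := basis_pair M rankM MB.
  have aL : a \notin loops M by apply/nonloopP; exists B; rewrite // EB !finset.inE eqxx.
  have bL : b \notin loops M by apply/nonloopP; exists B; rewrite // EB !finset.inE eqxx orbT.
  by exists a, b; rewrite eq_parallel_class // -EB MB.
have H : base_polytope (bases M) x <-> feasible (loops M) (parallel_class M) x.
  exact: base_polytopeP.
(* The colour sum and the class sum can differ only in loops, where [x] vanishes. *)
have sumE i : i \notin loops M -> (forall j, j \in loops M -> x 0 j = 0) ->
    \sum_(j | parallel_class M j == parallel_class M i) x 0 j =
    \sum_(j in parallel_class M i) x 0 j.
  move=> iL xL; rewrite big_mkcond [RHS]big_mkcond; apply: eq_bigr => j _.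
  have [jL|jL] := boolP (j \in loops M); first by rewrite xL // !if_same.
  by rewrite parallel_classE.
split=> [/H[x0 xL x2 x1]|[[x01 xL x2 _] x1]].
  split=> [|P /parallel_classesP[//|i iL ->]]; last by rewrite -sumE // x1.
  split=> // [i|]; last by rewrite big_set0 ler01.
  rewrite x0 /=; have [/xL->|iL] := boolP (i \in loops M); first exact: ler01.
  apply: le_trans (x1 i iL); rewrite (bigD1 i) //= lerDl.
  by apply: sumr_ge0.
apply/H; split=> // [i|i iL]; first by have /andP[] := x01 i.
by rewrite sumE // x1 //; apply/parallel_classesP => //; exists i.
Qed.

Lemma parallel_classes_disjoint P Q : P \in parallel_classes M ->
  Q \in parallel_classes M -> P != Q -> [disjoint P & Q].
Proof.
move=> /parallel_classesP[//|i iL ->] /parallel_classesP[//|j jL ->].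
apply: contraNT => /pred0Pn[k /= /andP[ki kj]].
have kL : k \notin loops M by move: ki; rewrite finset.inE => /andP[].
move: ki kj; rewrite !parallel_classE // => /eqP<- /eqP<-; exact: eqxx.
Qed.

Lemma loops_parallel_class_disjoint P : P \in parallel_classes M ->
  [disjoint loops M & P].
Proof.
move=> /imsetP[F _ ->]; rewrite disjoint_sym -finset.setI_eq0.
by rewrite finset.setIDAC finset.setDIl finset.setDv finset.setI0.
Qed.

(** An element completing some [i] of [P] to a basis lies neither in [P] nor among the loops. The
    strict bound places the class sizes in the range [k < n] of the final sum. *)
Lemma card_loops_parallel_class P : P \in parallel_classes M ->
  (#|loops M| + #|P| < n)%N.
Proof.
move=> PM; rewrite -[ltnRHS]card_ord.
have -> : (#|loops M| + #|P| = #|loops M :|: P|)%N.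
  by rewrite cardsU (disjoint_setI0 (loops_parallel_class_disjoint P PM)) cards0 subn0.
have /parallel_classesP[//|i iL ->] := PM.
have [B MB iB] := nonloopP M iL.
have [j nij EB] := basis_pair_mem M rankM MB iB.
rewrite -cardsT; apply: proper_card; apply/properP; split; first exact: finset.subsetT.
exists j; rewrite ?finset.in_setT // finset.in_setU negb_or.
have -> /= : j \notin loops M by apply/nonloopP; exists B; rewrite // EB !finset.inE eqxx orbT.
by rewrite finset.inE -EB MB andbF.
Qed.

(* The total mass is 2, so it exceeds 1 on at most one parallel class: the slices
   cut off by distinct classes are disjoint. *)
Lemma indic_base_polytope_rank2 x :
  let C := [set P in parallel_classes M | (2 <= #|P|)%N]%SET in
  \1_(base_polytope (bases M)) x =
    (1 - #|C|%:R) * \1_(slice (loops M) finset.set0) x +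
    \sum_(P in C) \1_(slice (loops M) P) x :> R.
Proof.
move=> C; have [Sx|Sx] := pselect (slice (loops M) finset.set0 x); last first.
  have no0 (X : set 'rV[R]_n) : ~ X x -> \1_X x = 0 :> R.
    by move=> nX; rewrite indicE memNset.
  rewrite !no0 // ?mulr0 ?add0r; last by move=> /base_polytope_rank2[].
  by rewrite big1 // => P _; apply: no0 => -[x01 xL x2 _]; apply: Sx; split; rewrite ?big_set0 ?ler01.
have [x01 xL x2 _] := Sx.
have x0 i : 0 <= x 0 i by have /andP[] := x01 i.
have sliceE P : \1_(slice (loops M) P) x = (\sum_(i in P) x 0 i <= 1)%R%:R :> R.
  rewrite indicE; congr (_%:R); congr nat_of_bool.
  by apply/idP/idP => [|le1]; rewrite in_setE; [case|split].
have smallP P : (#|P| <= 1)%N -> \sum_(i in P) x 0 i <= 1.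
  by move=> P1; have [] : slice (loops M) P x by rewrite slice_card_le1.
rewrite sliceE big_set0 ler01 mulr1; under eq_bigr do rewrite sliceE.
have [/existsP[P0 /andP[P0C P0x]]|/existsPn ok] :=
  boolP [exists P in C, ~~ (\sum_(i in P) x 0 i <= 1)].
  have P0M : P0 \in parallel_classes M by move: P0C; rewrite finset.inE => /andP[].
  rewrite indicE memNset; last by move=> /base_polytope_rank2[_ /(_ P0 P0M)]; exact/negP.
  (* With [P0] violated and every other class satisfied, the sum is [#|C| - 1], which cancels
     [1 - #|C|]. *)
  suff E : \sum_(P in C | P != P0) (\sum_(i in P) x 0 i <= 1)%R%:R
      = \sum_(P in C | P != P0) 1%:R :> R.
    rewrite -[#|C|]sum1_card natr_sum (bigD1 P0) //= [X in _ = _ + X](bigD1 P0) //=.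
    by rewrite (negbTE P0x) E add0r opprD addrA subrr add0r addNr.
  apply: eq_bigr => P /andP[PC nP].
  suff -> : \sum_(i in P) x 0 i <= 1 by [].
  have PM : P \in parallel_classes M by move: PC; rewrite finset.inE => /andP[].
  have D := parallel_classes_disjoint _ _ PM P0M nP.
  have le : \sum_(i in P) x 0 i <= \sum_(i | i \notin P0) x 0 i.
    rewrite big_mkcond [leRHS]big_mkcond; apply: ler_sum => i _.
    by case: ifP => [/(disjointFr D)->//|_]; case: ifP.
  by move: x2 P0x; rewrite (bigID (mem P0)) /= -ltNge => x2 lt1; lra.
(* With no class violated the sum is [#|C|] and the total is 1. *)
have -> : \sum_(P in C) (\sum_(i in P) x 0 i <= 1)%R%:R = #|C|%:R :> R.
  rewrite -sumr_const; apply: eq_bigr => P PC.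
  by have := ok P; rewrite PC negbK => ->.
rewrite subrK indicE mem_set //; apply/base_polytope_rank2; split=> // P PM.
have [/smallP//|P2] := leqP #|P| 1.
by have := ok P; rewrite finset.inE PM P2 negbK.
Qed.

End MatroidPolytope.

(** * Symmetrization and grouping of the classes by size *)

Theorem theorem3p5 (R : realType) (n : nat) (M : matroid 'I_n)
  (rankM : rank M [set: 'I_n]%SET = 2%N) :
  let l := #|loops M| in
  let p := #|[set P in parallel_classes M | (2 <= #|P|)%N]%SET| in
  let n_ (k : nat) := #|[set P in parallel_classes M | #|P| == k]%SET| in
  forall x : 'rV[R]_n,
    sym_indic (base_polytope (bases M)) x =
      (1 - p%:R) * sym_indic (base_polytope (schubert2_bases n l.+1 l.+2)) x +
      \sum_(2 <= k < n)
        (n_ k)%:R * sym_indic (base_polytope (schubert2_bases n l.+1 (l + k).+1)) x.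
Proof.
move=> l p n_ x; pose C := [set P in parallel_classes M | (2 <= #|P|)%N]%SET.
pose S k : set 'rV[R]_n := base_polytope (schubert2_bases n l.+1 (l + k).+1).
have symS (P : {set 'I_n}) : (0 < #|P|)%N -> [disjoint loops M & P] -> (l + #|P| <= n)%N ->
    sym_indic (slice (loops M) P) x = sym_indic (S #|P|) x.
  move=> P0 dP lPn; rewrite /S base_polytope_schubert2 //; apply: sym_indic_slice => //.
  - by rewrite -finset.setI_eq0; apply/eqP/setP => i; rewrite !finset.inE; lia.
  - rewrite -[LHS]subn0 -(card_ord_interval n 0) ?(leq_trans (leq_addr _ _) lPn) //.
  - by rewrite card_ord_interval // addKn.
(* The pointwise identity holds at every permuted point, so it survives averaging. *)
have -> : sym_indic (base_polytope (bases M)) x =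
    (1 - p%:R) * sym_indic (slice (loops M) finset.set0) x +
    \sum_(P in C) sym_indic (slice (loops M) P) x.
  rewrite /sym_indic -mulr_sumr mulrCA -mulrDr; congr (_ * _).
  rewrite exchange_big mulr_sumr -big_split /=; apply: eq_bigr => s _.
  exact: indic_base_polytope_rank2.
have CM P : P \in C -> P \in parallel_classes M /\ (2 <= #|P|)%N.
  by rewrite finset.inE => /andP[].
congr (_ * _ + _).
  have [B MB] := set0Pn _ (basesP M).1.
  have [i [j [nij EB]]] := basis_pair M rankM MB.
  have iL : i \notin loops M by apply/nonloopP; exists B; rewrite // EB !finset.inE eqxx.
  have iM : parallel_class M i \in parallel_classes M.
    by apply/parallel_classesP => //; exists i.
  (* The uncut slice is replaced by the slice of a singleton nonloop, whose symmetrization is that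
     of [S 1], that is, of [S(l+1, l+2)]. *)
  rewrite -(slice_card_le1 _ [set i]%SET) ?cards1 // symS ?cards1 //.
  - by rewrite /S addn1.
  - by rewrite disjoint_sym disjoints1.
  - rewrite addn1; exact: leq_ltn_trans (leq_addr _ _) (card_loops_parallel_class M rankM _ iM).
transitivity (\sum_(P in C) sym_indic (S #|P|) x).
  apply: eq_bigr => P /CM[PM P2]; apply: symS; first exact: ltnW.
    exact: loops_parallel_class_disjoint PM.
  exact/ltnW/card_loops_parallel_class.
(* Each term is spread over all [k], only [k = #|P|] contributing; after exchanging the sums, the
   classes of size [k] in [C] are counted by [n_ k] because [k >= 2]. *)
transitivity (\sum_(P in C) \sum_(2 <= k < n | k == #|P|) sym_indic (S k) x).
  apply: eq_bigr => P /CM[PM P2]; rewrite big_nat1_eq P2 /=.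
  by rewrite (leq_ltn_trans (leq_addl _ _) (card_loops_parallel_class M rankM _ PM)).
rewrite (exchange_big_dep xpredT) //=; apply: eq_big_nat => k /andP[k2 _].
rewrite sumr_const mulr_natl; congr (_ *+ _); apply: eq_card => P.
rewrite !finset.inE unfold_in /= finset.inE eq_sym.
by case: eqP => [->|_]; rewrite ?andbF // k2 !andbT.
Qed.
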